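(* Let $(\rho_k,\rho_k\vec v_k,E_k,\vec B)_{k=1,\dots,N_i}$, with $\rho_k>0$, $p_k>0$, be a smooth solution on a domain in $\mathbb R^3$ of the system, for $k=1,\dots,N_i$, $$\partial_t\rho_k+\nabla\cdot(\rho_k\vec v_k)=0,$$ $$\partial_t(\rho_k\vec v_k)+\nabla\cdot(\rho_k\vec v_k\vec v_k^{\,T}+p_kI)+r_k\rho_k(\vec v^+-\vec v_k)\times\vec B-\frac{r_k\rho_k}{n_ee}\big((\nabla\times\vec B)\times\vec B-\nabla p_e\big)=0,$$ $$\partial_tE_k+\nabla\cdot\big(\vec v_k(\mathcal E_k+p_k)\big)+r_k\rho_k\vec v_k\cdot\big((\vec v^+-\vec v_k)\times\vec B\big)-\frac{r_k\rho_k\vec v_k}{n_ee}\cdot\big((\nabla\times\vec B)\times\vec B-\nabla p_e\big)-\vec B\cdot\big(\nabla\times(\vec v^+\times\vec B)\big)=0,$$ $$\partial_t\vec B-\nabla\times(\vec v^+\times\vec B)=0.$$ Then $$\frac{\partial S}{\partial t}+\nabla\cdot\vec f^S=0,\qquad S=\sum_{k=1}^{N_i}\frac{-\rho_ks_k}{\gamma_k-1},\qquad \vec f^S=\sum_{k=1}^{N_i}\vec v_k\Big(\frac{-\rho_ks_k}{\gamma_k-1}\Big),$$ where $s_k=\ln p_k-\gamma_k\ln\rho_k$.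
   Context: There are $N_i\ge1$ ion species with constants $\gamma_k>1$ (heat capacity ratios) and $r_k$ (charge-to-mass ratios). For species $k$: density $\rho_k$, velocity $\vec v_k\in\mathbb R^3$, pressure $p_k$, hydrodynamic energy $\mathcal E_k=\tfrac12\rho_k\|\vec v_k\|^2+\frac{p_k}{\gamma_k-1}$; the magnetic field is $\vec B$, and $E_k=\mathcal E_k+\frac12\|\vec B\|^2$. The total electron charge is $n_ee=\sum_kr_k\rho_k$ (assumed nonzero), the charge-averaged velocity is $\vec v^+=\frac{1}{n_ee}\sum_kr_k\rho_k\vec v_k$, and $p_e$ is a given smooth scalar field (the electron pressure, prescribed by some model). No assumption is made on $\nabla\cdot\vec B$. *)

(* Defs.v *)
From HB Require Import structures.
From mathcomp Require Import all_boot all_order all_algebra.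
From mathcomp Require Import all_classical all_reals all_analysis.
Set Implicit Arguments.
Unset Strict Implicit.
Unset Printing Implicit Defensive.
Import Order.TTheory GRing.Theory Num.Theory.
Import numFieldNormedType.Exports.
Local Open Scope classical_set_scope.
Local Open Scope ring_scope.

(* Vectors of R^3 are row vectors. Fields on space-time are curried,
   time first. *)
Notation scalar_field R := (R -> 'rV[R]_3 -> R).
Notation vector_field R := (R -> 'rV[R]_3 -> 'rV[R]_3).

(* [`|v|] on ['rV[R]_3] is the sup norm; the squared Euclidean norm of [v] is
   [dot v v]. *)
Definition dot (R : realType) (u v : 'rV[R]_3) : R :=
  \sum_(i < 3) u 0 i * v 0 i.

(* Additions in ['I_3] are modulo 3, so the three components of [cross] and of
   [curl] below are cyclic permutations of one formula. *)
Definition cross (R : realType) (u v : 'rV[R]_3) : 'rV[R]_3 :=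
  \row_(i < 3) (u 0 (i + 1) * v 0 (i + 2) - u 0 (i + 2) * v 0 (i + 1)).

Definition partial (R : realType) (j : 'I_3) (f : 'rV[R]_3 -> R)
    (x : 'rV[R]_3) : R :=
  'D_(delta_mx 0 j) f x.

Definition grad (R : realType) (f : 'rV[R]_3 -> R) (x : 'rV[R]_3) : 'rV[R]_3 :=
  \row_(j < 3) partial j f x.

Definition div (R : realType) (F : 'rV[R]_3 -> 'rV[R]_3) (x : 'rV[R]_3) : R :=
  \sum_(j < 3) partial j (fun y => F y 0 j) x.

Definition div_tensor (R : realType) (T : 'rV[R]_3 -> 'M[R]_3)
    (x : 'rV[R]_3) : 'rV[R]_3 :=
  \row_(i < 3) \sum_(j < 3) partial j (fun y => T y i j) x.

Definition curl (R : realType) (F : 'rV[R]_3 -> 'rV[R]_3)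
    (x : 'rV[R]_3) : 'rV[R]_3 :=
  \row_(i < 3) (partial (i + 1) (fun y => F y 0 (i + 2)) x
                - partial (i + 2) (fun y => F y 0 (i + 1)) x).

Definition dt (R : realType) (V : normedModType R) (f : R -> 'rV[R]_3 -> V)
    (t : R) (x : 'rV[R]_3) : V :=
  derive1 (fun s => f s x) t.

Definition domain (R : realType) (Omega : set 'rV[R]_3) : Prop :=
  [/\ Omega !=set0, open Omega & connected Omega].

(* Jointly continuously differentiable in (t, x) on [J `*` Omega]; meant for
   open [J] and [Omega]. *)
Definition smooth_on (R : realType) (V : normedModType R) (J : set R)
    (Omega : set 'rV[R]_3) (f : R -> 'rV[R]_3 -> V) : Prop :=
  let g := fun z : R * 'rV[R]_3 => f z.1 z.2 in
  forall z : R * 'rV[R]_3, (J `*` Omega) z ->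
    differentiable g z /\
    forall w : R * 'rV[R]_3, {for z, continuous ('D_w g)}.

Section multi_ion.
Context {R : realType} {N : nat}.
Implicit Types (gamma r : 'I_N -> R) (rho p : 'I_N -> scalar_field R)
  (v : 'I_N -> vector_field R) (B : vector_field R) (pe : scalar_field R).

Definition hydro_energy gamma rho v p (k : 'I_N) : scalar_field R :=
  fun t x => 2^-1 * rho k t x * dot (v k t x) (v k t x)
             + p k t x / (gamma k - 1).

Definition total_energy gamma rho v p B (k : 'I_N) : scalar_field R :=
  fun t x => hydro_energy gamma rho v p k t x + 2^-1 * dot (B t x) (B t x).

(* The product n_e e of the electron number density and the elementary charge. *)
Definition electron_charge r rho : scalar_field R :=
  fun t x => \sum_(k < N) r k * rho k t x.

(* The charge-averaged velocity v^+. *)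
Definition avg_velocity r rho v : vector_field R :=
  fun t x => (electron_charge r rho t x)^-1 *:
             \sum_(k < N) (r k * rho k t x) *: v k t x.

(* [v^T *m v] is the dyad of the paper's column vectors, since [v] is a row. *)
Definition momentum_flux rho v p (k : 'I_N) : R -> 'rV[R]_3 -> 'M[R]_3 :=
  fun t x => rho k t x *: ((v k t x)^T *m v k t x) + (p k t x)%:M.

Definition drift_force r rho v B (k : 'I_N) : vector_field R :=
  fun t x => cross (avg_velocity r rho v t x - v k t x) (B t x).

Definition electron_force B pe : vector_field R :=
  fun t x => cross (curl (B t) x) (B t x) - grad (pe t) x.

Definition induction_term r rho v B : vector_field R :=
  fun t x => curl (fun y => cross (avg_velocity r rho v t y) (B t y)) x.

Definition log_entropy gamma rho p (k : 'I_N) : scalar_field R :=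
  fun t x => ln (p k t x) - gamma k * ln (rho k t x).

Definition species_entropy gamma rho p (k : 'I_N) : scalar_field R :=
  fun t x => - (rho k t x * log_entropy gamma rho p k t x) / (gamma k - 1).

Definition entropy gamma rho p : scalar_field R :=
  fun t x => \sum_(k < N) species_entropy gamma rho p k t x.

Definition entropy_flux gamma rho v p : vector_field R :=
  fun t x => \sum_(k < N) species_entropy gamma rho p k t x *: v k t x.

End multi_ion.

(* Main.v *)
Require Import Defs.
From HB Require Import structures.
From mathcomp Require Import all_boot all_order all_algebra.
From mathcomp Require Import all_classical all_reals all_analysis.
From mathcomp Require Import ring.
Import Order.TTheory GRing.Theory Num.Theory.
Import numFieldNormedType.Exports.
Local Open Scope classical_set_scope.
Local Open Scope ring_scope.

(** The entropy is conserved species by species.  To a single species, the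
    rest of the system is an external force density [f]: the momentum equation
    contains [f], and the energy equation contains exactly its power
    [dot v f]: the Lorentz, Hall and electron-pressure terms enter both
    equations in this way.  The remaining term of the energy equation,
    B . curl (v^+ x B), is by the induction equation the time derivative of the
    magnetic energy included in E_k ([derive_total_energy]).

    Subtracting v . (momentum) from the energy equation, and adding |v|^2 / 2
    times the mass equation, eliminates [f] and the kinetic energy and leaves
      p_t + v . grad p + gamma p div v = 0      ([pressure_balance]).
    Together with the mass equation this says that s = ln p - gamma ln rho is
    constant along the flow of the species, so any multiple of rho s is
    conserved ([entropy_production], [species_entropy_balance]).  Summing over
    the species gives the theorem.

    These computations use the product and chain rules for the primitive
    variables, whereas the hypotheses give regularity of the conservative ones.
    Velocity is momentum over density ([derivable_quotient]), and pressure is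
    an algebraic expression in energy, density, velocity and magnetic field
    ([derivable_pressure]).  Time and space derivatives are treated alike by
    seeing both as directional derivatives of fields on R * R^3
    ([dt_joint], [partial_joint]). *)

Set Implicit Arguments.
Unset Strict Implicit.
Unset Printing Implicit Defensive.

(** * Directional derivatives *)

(** A directional derivative only depends on the restriction of the function
    to a line; the two functions may live on different spaces. *)
Lemma eq_derive_line (R : numFieldType) (U V W : normedModType R)
    (f : U -> W) (g : V -> W) (a u : U) (b v : V) :
  (forall h : R, f (h *: u + a) = g (h *: v + b)) -> 'D_u f a = 'D_v g b.
Proof.
move=> fg; have fg0 : f a = g b by have := fg 0; rewrite !scale0r !add0r.
rewrite /derive; set F := (fun h : R => _); set G := (fun h : R => _).
by suff -> : F = G by []; apply/funext => h; rewrite /F /G /= fg fg0.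
Qed.

Section directional_derivatives.
Context {R : realType} {V : normedModType R}.
Implicit Types (f g : V -> R) (z w : V).

Lemma eq_is_derive f g z w df dg :
  f =1 g -> df = dg -> is_derive z w f df -> is_derive z w g dg.
Proof. by move=> /funext -> ->. Qed.

Lemma is_derive_mul f g z w df dg :
  is_derive z w f df -> is_derive z w g dg ->
  is_derive z w (fun y => f y * g y) (df * g z + f z * dg).
Proof.
move=> hf hg; apply: (is_derive_eq (is_deriveM hf hg)).
by rewrite addrC [g z *: df]mulrC.
Qed.

Lemma is_derive_mulr f z w (a df : R) :
  is_derive z w f df -> is_derive z w (fun y => f y * a) (df * a).
Proof.
move=> hf; apply: (is_derive_eq (is_derive_mul hf (is_derive_cst a z w))).
by rewrite mulr0 addr0.
Qed.

Lemma is_derive_ln_comp f z w df :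
  0 < f z -> is_derive z w f df ->
  is_derive z w (fun y => ln (f y)) (df / f z).
Proof.
move=> fz [dfz <-].
(* On the line through z in the direction w the one-variable chain rule
   applies. *)
have E g : 'D_w g z = 'D_1 (fun h : R => g (h *: w + z)) 0 :> R.
  by apply: eq_derive_line => h; rewrite addr0 [h%:A]mulr1.
have D0 : is_derive (0 : R) 1 (fun h : R => f (h *: w + z)) ('D_w f z).
  by rewrite (E f); apply: derivableP; exact: (derivable1P f z w).1.
have L : is_derive (f (0 *: w + z)) 1 (@ln R) (f z)^-1.
  by rewrite scale0r add0r; exact: is_derive1_ln.
have C := is_derive1_comp L D0.
split; first by apply: (derivable1P (fun y => ln (f y)) z w).2; case: C.
by rewrite (E (fun y => ln (f y))) mulrC; case: C.
Qed.

Lemma is_derive_dot (u v : V -> 'rV[R]_3) z w (du dv : 'I_3 -> R) :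
  (forall i, is_derive z w (fun y => u y 0 i) (du i)) ->
  (forall i, is_derive z w (fun y => v y 0 i) (dv i)) ->
  is_derive z w (fun y => dot (u y) (v y))
    (\sum_(i < 3) (du i * v z 0 i + u z 0 i * dv i)).
Proof.
move=> hu hv; have := is_derive_sum (fun i => is_derive_mul (hu i) (hv i)).
by apply: eq_is_derive => // y; rewrite /dot fct_sumE.
Qed.

Lemma derive_coord (F : V -> 'rV[R]_3) z w i :
  derivable F z w -> ('D_w F z) 0 i = 'D_w (fun y => F y 0 i) z.
Proof. by move=> dF; rewrite derive_mx// mxE. Qed.

Lemma derivable_coord (F : V -> 'rV[R]_3) z w i :
  derivable F z w -> derivable (fun y => F y 0 i) z w.
Proof. by move=> /derivable_mxP; apply. Qed.

Lemma derivable_quotient f g h z w :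
  (\forall y \near z, g y != 0) -> (forall y, f y = g y * h y) ->
  derivable f z w -> derivable g z w -> derivable h z w.
Proof.
move=> g0 fgh df dg.
apply: (@near_eq_derivable _ _ _ (fun y => f y * (g y)^-1)).
  near=> y; rewrite fgh mulrAC mulfV ?mul1r//.
  by near: y.
exact: (derivableM df (derivableV (nbhs_singleton g0) dg)).
Unshelve. all: by end_near. Qed.

End directional_derivatives.

(** * Fields on space-time *)

Section space_time.
Context {R : realType}.

Definition joint {W : Type} (f : R -> 'rV[R]_3 -> W) : R * 'rV[R]_3 -> W :=
  fun z => f z.1 z.2.

Definition time_dir : R * 'rV[R]_3 := (1, 0).
Definition space_dir (j : 'I_3) : R * 'rV[R]_3 := (0, delta_mx 0 j).

Lemma dt_joint (W : normedModType R) (f : R -> 'rV[R]_3 -> W) t x :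
  dt f t x = 'D_time_dir (joint f) (t, x).
Proof.
rewrite /dt derive1E; apply: eq_derive_line => h.
by rewrite /joint /= scaler0 add0r.
Qed.

Lemma partial_joint (f : scalar_field R) j t x :
  partial j (f t) x = 'D_(space_dir j) (joint f) (t, x).
Proof. by apply: eq_derive_line => h; rewrite /joint /= scaler0 add0r. Qed.

Lemma div_joint (F : vector_field R) t x :
  div (F t) x =
  \sum_(j < 3) ('D_(space_dir j) (joint (fun s y => F s y 0 j)) (t, x) : R).
Proof.
by apply: eq_bigr => j _; rewrite -(partial_joint (fun s y => F s y 0 j)).
Qed.

Lemma smooth_on_derivable (W : normedModType R) J Omega
    (f : R -> 'rV[R]_3 -> W) t x w :
  smooth_on J Omega f -> J t -> Omega x -> derivable (joint f) (t, x) w.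
Proof.
by move=> fS Jt Ox; apply: diff_derivable; case: (fS (t, x)).
Qed.

Lemma joint_near (J : set R) (Omega : set 'rV[R]_3) (t : R) (x : 'rV[R]_3) :
  open J -> open Omega -> J t -> Omega x ->
  \forall z \near (t, x), J z.1 /\ Omega z.2.
Proof.
move=> oJ oO Jt Ox; exists (J, Omega) => //=.
by split; [exact: open_nbhs_nbhs | exact: open_nbhs_nbhs].
Qed.

End space_time.

(** * Derivatives of the densities and fluxes of one species *)

Section species_derivatives.
Context {R : realType} {N : nat} (gamma : 'I_N -> R)
  (rho p : 'I_N -> scalar_field R) (v : 'I_N -> vector_field R)
  (B : vector_field R) (k : 'I_N) (z w : R * 'rV[R]_3)
  (drho dp : R) (dv : 'I_3 -> R).
Context (is_drho : is_derive z w (joint (rho k)) drho)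
  (is_dp : is_derive z w (joint (p k)) dp)
  (is_dv : forall i, is_derive z w (joint (fun s y => v k s y 0 i)) (dv i)).

Let rhoz := joint (rho k) z.
Let pz := joint (p k) z.
Let vz i := joint (v k) z 0 i.

Lemma is_derive_momentum i :
  is_derive z w (joint (fun s y => (rho k s y *: v k s y) 0 i))
    (drho * vz i + rhoz * dv i).
Proof.
have := is_derive_mul is_drho (is_dv i).
by apply: eq_is_derive => // y; rewrite /joint mxE.
Qed.

Lemma is_derive_momentum_flux i j :
  is_derive z w (joint (fun s y => momentum_flux rho v p k s y i j))
    ((drho * vz i + rhoz * dv i) * vz j + rhoz * vz i * dv j
     + dp * (i == j)%:R).
Proof.
have dm := is_derive_mul (is_derive_mul is_drho (is_dv i)) (is_dv j).
have := is_deriveD dm (is_derive_mulr (i == j)%:R is_dp).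
apply: eq_is_derive => // y.
by rewrite /joint /momentum_flux !mxE big_ord1 !mxE -[in RHS]mulr_natr mulrA.
Qed.

Lemma is_derive_hydro_energy :
  is_derive z w (joint (hydro_energy gamma rho v p k))
    (2^-1 * drho * (\sum_(i < 3) vz i ^+ 2)
     + rhoz * (\sum_(i < 3) vz i * dv i) + dp / (gamma k - 1)).
Proof.
have dk := is_derive_mul (is_derive_mulr 2^-1 is_drho)
  (is_derive_dot is_dv is_dv).
have := is_deriveD dk (is_derive_mulr (gamma k - 1)^-1 is_dp).
apply: eq_is_derive.
  by move=> y; rewrite /joint /hydro_energy [2^-1 * _]mulrC.
rewrite /dot /vz /rhoz /joint !big_ord_recl !big_ord0.
by set c := (gamma k - 1)^-1; field.
Qed.

Lemma is_derive_species_entropy : 0 < rhoz -> 0 < pz ->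
  is_derive z w (joint (species_entropy gamma rho p k))
    (- (drho * joint (log_entropy gamma rho p k) z
        + rhoz * (dp / pz - gamma k * (drho / rhoz))) / (gamma k - 1)).
Proof.
move=> rho0 p0.
have ds := is_deriveB (is_derive_ln_comp p0 is_dp)
  (is_derive_mulr (gamma k) (is_derive_ln_comp rho0 is_drho)).
have := is_derive_mulr (- (gamma k - 1)^-1) (is_derive_mul is_drho ds).
apply: eq_is_derive.
  move=> y; rewrite /joint /species_entropy /log_entropy [gamma k * _]mulrC.
  by rewrite mulrN mulNr.
rewrite [gamma k * _]mulrC mulrN mulNr /joint /log_entropy.
by rewrite [gamma k * _]mulrC.
Qed.

Lemma is_derive_entropy_flux j : 0 < rhoz -> 0 < pz ->
  is_derive z w
    (joint (fun s y => (species_entropy gamma rho p k s y *: v k s y) 0 j))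
    ('D_w (joint (species_entropy gamma rho p k)) z * vz j
     + joint (species_entropy gamma rho p k) z * dv j).
Proof.
move=> rho0 p0; have ds := is_derive_species_entropy rho0 p0.
have := is_derive_mul ds (is_dv j); apply: eq_is_derive => [y|].
  by rewrite /joint mxE.
by rewrite (derive_val (is_derive := ds)).
Qed.

Lemma derive_total_energy : derivable (joint B) z w ->
  'D_w (joint (total_energy gamma rho v p B k)) z =
  'D_w (joint (hydro_energy gamma rho v p k)) z
  + dot (joint B z) ('D_w (joint B) z).
Proof.
move=> dB; have is_dB i := derivableP (derivable_coord (i := i) dB).
have db := is_derive_mulr 2^-1 (is_derive_dot is_dB is_dB).
rewrite (derive_val (is_derive := is_derive_hydro_energy)).
have := derive_val (is_derive := is_deriveD is_derive_hydro_energy db).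
have -> : joint (hydro_energy gamma rho v p k)
    + (fun y => dot (joint B y) (joint B y) * 2^-1)
  = joint (total_energy gamma rho v p B k).
  apply/funext => y; rewrite /joint /total_energy /=.
  by rewrite [2^-1 * dot _ _]mulrC.
move=> ->; congr (_ + _); rewrite mulr_suml.
refine (eq_bigr _ _) => i _.
by rewrite derive_coord// /joint /=; field.
Qed.

End species_derivatives.

Lemma derivable_pressure (R : realType) (N : nat) (gamma : 'I_N -> R)
    (rho p : 'I_N -> scalar_field R) (v : 'I_N -> vector_field R)
    (B : vector_field R) (k : 'I_N) (z w : R * 'rV[R]_3) :
  gamma k != 1 ->
  derivable (joint (rho k)) z w ->
  (forall i, derivable (joint (fun s y => v k s y 0 i)) z w) ->
  derivable (joint B) z w ->
  derivable (joint (total_energy gamma rho v p B k)) z w ->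
  derivable (joint (p k)) z w.
Proof.
move=> g1 drho dv dB dE; have g10 : gamma k - 1 != 0 by rewrite subr_eq0.
have is_dv i := derivableP (dv i).
have is_dB i := derivableP (derivable_coord (i := i) dB).
have dk := is_derive_mul (is_derive_mulr 2^-1 (derivableP drho))
  (is_derive_dot is_dv is_dv).
have db := is_derive_mulr 2^-1 (is_derive_dot is_dB is_dB).
have H := is_derive_mulr (gamma k - 1)
  (is_deriveB (is_deriveB (derivableP dE) db) dk).
apply: (ex_derive (is_derive := eq_is_derive (g := joint (p k)) _ erefl H)).
move=> y; transitivity ((total_energy gamma rho v p B k y.1 y.2
  - dot (B y.1 y.2) (B y.1 y.2) * 2^-1
  - rho k y.1 y.2 * 2^-1 * dot (v k y.1 y.2) (v k y.1 y.2))
  * (gamma k - 1)) => //.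
by rewrite /total_energy /hydro_energy /joint; field.
Qed.

(** * Pointwise algebra of the balance laws *)

(** The suffixes [_t] and [_x] stand for the values at one point of the time
    derivative and of the partial derivatives; [v_x j i] is the derivative of
    the component [i] in the direction [j]. *)
Lemma pressure_balance (R : realType) (g rho p rho_t p_t : R)
    (v v_t rho_x p_x f : 'I_3 -> R) (v_x : 'I_3 -> 'I_3 -> R) :
  g != 1 ->
  rho_t + \sum_(j < 3) (rho_x j * v j + rho * v_x j j) = 0 ->
  (forall i, rho_t * v i + rho * v_t i
     + \sum_(j < 3) ((rho_x j * v i + rho * v_x j i) * v j
                     + rho * v i * v_x j j + p_x j * (i == j)%:R)
     + f i = 0) ->
  2^-1 * rho_t * (\sum_(i < 3) v i ^+ 2) + rho * (\sum_(i < 3) v i * v_t i)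
  + p_t / (g - 1)
  + \sum_(j < 3)
      ((2^-1 * rho_x j * (\sum_(i < 3) v i ^+ 2)
        + rho * (\sum_(i < 3) v i * v_x j i) + p_x j / (g - 1) + p_x j) * v j
       + (2^-1 * rho * (\sum_(i < 3) v i ^+ 2) + p / (g - 1) + p) * v_x j j)
  + \sum_(i < 3) v i * f i = 0 ->
  p_t + \sum_(j < 3) p_x j * v j + g * p * \sum_(j < 3) v_x j j = 0.
Proof.
move=> g1 mass mom energy.
have g10 : g - 1 != 0 by rewrite subr_eq0.
set mass_lhs := (X in X = 0) in mass.
pose mom_lhs i := rho_t * v i + rho * v_t i
  + \sum_(j < 3) ((rho_x j * v i + rho * v_x j i) * v j
                  + rho * v i * v_x j j + p_x j * (i == j)%:R) + f i.
set energy_lhs := (X in X = 0) in energy.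
have -> : p_t + \sum_(j < 3) p_x j * v j + g * p * \sum_(j < 3) v_x j j =
  (g - 1) * (energy_lhs - \sum_(i < 3) v i * mom_lhs i
             + 2^-1 * (\sum_(i < 3) v i ^+ 2) * mass_lhs).
  rewrite /energy_lhs /mass_lhs /mom_lhs !big_ord_recl !big_ord0 /=.
  by field.
rewrite mass energy big1 => [|i _]; first by ring.
by rewrite /mom_lhs mom mulr0.
Qed.

(** The value [s] of ln p - gamma ln rho is arbitrary here, because it only
    multiplies the mass balance.  The function [v_x] is the diagonal of the
    velocity gradient: [v_x j] is the derivative of the component [j] in the
    direction [j]. *)
Lemma entropy_production (R : realType) (g rho p s rho_t p_t : R)
    (v rho_x p_x v_x : 'I_3 -> R) :
  g != 1 -> rho != 0 -> p != 0 ->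
  rho_t + \sum_(j < 3) (rho_x j * v j + rho * v_x j) = 0 ->
  p_t + \sum_(j < 3) p_x j * v j + g * p * \sum_(j < 3) v_x j = 0 ->
  - (rho_t * s + rho * (p_t / p - g * (rho_t / rho))) / (g - 1)
  + \sum_(j < 3)
      (- (rho_x j * s + rho * (p_x j / p - g * (rho_x j / rho))) / (g - 1) * v j
       + - (rho * s) / (g - 1) * v_x j) = 0.
Proof.
move=> g1 rho0 p0 mass pressure.
have g10 : g - 1 != 0 by rewrite subr_eq0.
set mass_lhs := (X in X = 0) in mass.
set pressure_lhs := (X in X = 0) in pressure.
rewrite [LHS](_ : _ = (g - s) / (g - 1) * mass_lhs
                      - rho / ((g - 1) * p) * pressure_lhs).
  by rewrite mass pressure; ring.
rewrite /mass_lhs /pressure_lhs !big_ord_recl !big_ord0.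
by field; rewrite rho0 p0 g10.
Qed.

(** * Entropy balance *)

Section entropy_balance.
Context {R : realType} {N : nat} (gamma : 'I_N -> R)
  (rho p : 'I_N -> scalar_field R) (v : 'I_N -> vector_field R)
  (t : R) (x : 'rV[R]_3).
Context (rho_gt0 : forall k, 0 < rho k t x) (p_gt0 : forall k, 0 < p k t x)
  (drho : forall k w, derivable (joint (rho k)) (t, x) w)
  (dp : forall k w, derivable (joint (p k)) (t, x) w)
  (dv : forall k i w, derivable (joint (fun s y => v k s y 0 i)) (t, x) w).

Let is_drho k w := derivableP (@drho k w).
Let is_dp k w := derivableP (@dp k w).
Let is_dv k w i := derivableP (@dv k i w).

(** The entropy of a species is conserved under an arbitrary force density
    [- f], as long as this force does work at the rate [- dot v f]. *)
Lemma species_entropy_balance k (f : 'rV[R]_3) :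
  gamma k != 1 ->
  dt (rho k) t x + div (fun y => rho k t y *: v k t y) x = 0 ->
  dt (fun s y => rho k s y *: v k s y) t x
    + div_tensor (momentum_flux rho v p k t) x + f = 0 ->
  dt (hydro_energy gamma rho v p k) t x
    + div (fun y => (hydro_energy gamma rho v p k t y + p k t y) *: v k t y) x
    + dot (v k t x) f = 0 ->
  dt (species_entropy gamma rho p k) t x
    + div (fun y => species_entropy gamma rho p k t y *: v k t y) x = 0.
Proof.
move=> g1 mass mom energy.
pose D w (h : scalar_field R) : R := 'D_w (joint h) (t, x).
pose vc i s y := v k s y 0 i.
have massD : D time_dir (rho k) +
    \sum_(j < 3) (D (space_dir j) (rho k) * v k t x 0 j
                  + rho k t x * D (space_dir j) (vc j)) = 0.
  rewrite -[RHS]mass dt_joint (div_joint (fun s y => rho k s y *: v k s y)).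
  congr (_ + _); refine (eq_bigr _ _) => j _; apply: esym.
  exact: (derive_val
    (is_derive := is_derive_momentum (is_drho k _) (is_dv k _) j)).
have momD i : D time_dir (rho k) * v k t x 0 i + rho k t x * D time_dir (vc i)
    + \sum_(j < 3)
        ((D (space_dir j) (rho k) * v k t x 0 i
          + rho k t x * D (space_dir j) (vc i)) * v k t x 0 j
         + rho k t x * v k t x 0 i * D (space_dir j) (vc j)
         + D (space_dir j) (p k) * (i == j)%:R)
    + f 0 i = 0.
  have := congr1 (fun u : 'rV_3 => u 0 i) mom; rewrite !mxE => mom_i.
  rewrite -[RHS]mom_i; congr (_ + _ + _).
    rewrite dt_joint derive_coord; last first.
      apply/derivable_mxP => a b; rewrite (ord1 a).
      exact: (ex_derive
        (is_derive := is_derive_momentum (is_drho k _) (is_dv k _) b)).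
    apply: esym; exact: (derive_val
      (is_derive := is_derive_momentum (is_drho k _) (is_dv k _) i)).
  refine (eq_bigr _ _) => j _; apply: esym.
  rewrite (partial_joint (fun s y => momentum_flux rho v p k s y i j)).
  exact: (derive_val (is_derive :=
    is_derive_momentum_flux (is_drho k _) (is_dp k _) (is_dv k _) i j)).
have is_dh w :=
  is_derive_hydro_energy gamma (is_drho k w) (is_dp k w) (is_dv k w).
have energyD : 2^-1 * D time_dir (rho k) * (\sum_(i < 3) v k t x 0 i ^+ 2)
    + rho k t x * (\sum_(i < 3) v k t x 0 i * D time_dir (vc i))
    + D time_dir (p k) / (gamma k - 1)
    + \sum_(j < 3)
      ((2^-1 * D (space_dir j) (rho k) * (\sum_(i < 3) v k t x 0 i ^+ 2)
        + rho k t x * (\sum_(i < 3) v k t x 0 i * D (space_dir j) (vc i))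
        + D (space_dir j) (p k) / (gamma k - 1) + D (space_dir j) (p k))
       * v k t x 0 j
       + (2^-1 * rho k t x * (\sum_(i < 3) v k t x 0 i ^+ 2)
          + p k t x / (gamma k - 1) + p k t x) * D (space_dir j) (vc j))
    + \sum_(i < 3) v k t x 0 i * f 0 i = 0.
  rewrite -[RHS]energy dt_joint (derive_val (is_derive := is_dh time_dir)).
  congr (_ + _ + _).
  rewrite (div_joint (fun s y =>
    (hydro_energy gamma rho v p k s y + p k s y) *: v k s y)).
  refine (eq_bigr _ _) => j _; apply: esym.
  have H := is_derive_mul
    (is_deriveD (is_dh (space_dir j)) (is_dp k (space_dir j)))
    (is_dv k (space_dir j) j).
  rewrite (derive_val (is_derive := eq_is_derive (g := joint (fun s y =>
    ((hydro_energy gamma rho v p k s y + p k s y) *: v k s y) 0 j))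
    _ erefl H)) => [|y]; last by rewrite /joint mxE.
  have hE : hydro_energy gamma rho v p k t x =
      2^-1 * rho k t x * (\sum_(i < 3) v k t x 0 i ^+ 2)
      + p k t x / (gamma k - 1) by [].
  by rewrite -hE.
have is_ds w := is_derive_species_entropy gamma
  (is_drho k w) (is_dp k w) (rho_gt0 k) (p_gt0 k).
rewrite dt_joint (derive_val (is_derive := is_ds time_dir)).
rewrite (div_joint (fun s y => species_entropy gamma rho p k s y *: v k s y)).
rewrite -[RHS](entropy_production (log_entropy gamma rho p k t x) g1
  (lt0r_neq0 (rho_gt0 k)) (lt0r_neq0 (p_gt0 k)) massD
  (pressure_balance g1 massD momD energyD)).
congr (_ + _); refine (eq_bigr _ _) => j _.
rewrite (derive_val (is_derive := is_derive_entropy_flux gamma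
  (is_drho k _) (is_dp k _) (is_dv k _) j (rho_gt0 k) (p_gt0 k))).
by rewrite (derive_val (is_derive := is_ds (space_dir j))).
Qed.

Lemma entropy_balance_sum :
  dt (entropy gamma rho p) t x + div (entropy_flux gamma rho v p t) x =
  \sum_(k < N) (dt (species_entropy gamma rho p k) t x
    + div (fun y => species_entropy gamma rho p k t y *: v k t y) x).
Proof.
have deta k w : derivable (joint (species_entropy gamma rho p k)) (t, x) w.
  exact: (ex_derive (is_derive := is_derive_species_entropy gamma
    (is_drho k w) (is_dp k w) (rho_gt0 k) (p_gt0 k))).
have dflux k w j := is_derive_entropy_flux gamma
  (is_drho k w) (is_dp k w) (is_dv k w) j (rho_gt0 k) (p_gt0 k).
rewrite big_split /=; congr (_ + _).
  rewrite dt_joint; under eq_bigr do rewrite dt_joint.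
  have -> : joint (entropy gamma rho p)
      = \sum_(k < N) joint (species_entropy gamma rho p k).
    by apply/funext => z; rewrite fct_sumE.
  exact: derive_sum.
rewrite div_joint.
under [RHS]eq_bigr => k _ do
  rewrite (div_joint (fun s y => species_entropy gamma rho p k s y *: v k s y)).
rewrite exchange_big /=; refine (eq_bigr _ _) => j _.
have -> : joint (fun s y => entropy_flux gamma rho v p s y 0 j)
    = \sum_(k < N) joint (fun s y =>
        (species_entropy gamma rho p k s y *: v k s y) 0 j).
  by apply/funext => z; rewrite fct_sumE /joint /entropy_flux summxE.
by apply: derive_sum => k; exact: (ex_derive (is_derive := dflux k _ j)).
Qed.

End entropy_balance.

Lemma dot_scaleB (R : realType) (a b : R) (u f g : 'rV[R]_3) :
  dot u (a *: f - b *: g) = a * dot u f - dot (b *: u) g.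
Proof.
rewrite /dot mulr_sumr -sumrB; apply: eq_bigr => i _.
by rewrite !mxE; ring.
Qed.

Unset Implicit Arguments.

Theorem mainTheorem2 (R : realType) (N : nat) (N_ge1 : (1 <= N)%N)
  (gamma r : 'I_N -> R) (gamma_gt1 : forall k, 1 < gamma k)
  (J : set R) (J_open : open J) (J_itv : is_interval J)
  (Omega : set 'rV[R]_3) (Omega_domain : domain Omega)
  (rho : 'I_N -> scalar_field R) (v : 'I_N -> vector_field R)
  (p : 'I_N -> scalar_field R) (B : vector_field R) (pe : scalar_field R)
  (rho_gt0 : forall k t x, J t -> Omega x -> 0 < rho k t x)
  (p_gt0 : forall k t x, J t -> Omega x -> 0 < p k t x)
  (charge_neq0 : forall t x, J t -> Omega x -> electron_charge r rho t x != 0)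
  (rho_smooth : forall k, smooth_on J Omega (rho k))
  (momentum_smooth :
    forall k, smooth_on J Omega (fun t x => rho k t x *: v k t x))
  (energy_smooth :
    forall k, smooth_on J Omega (total_energy gamma rho v p B k))
  (B_smooth : smooth_on J Omega B)
  (pe_smooth : smooth_on J Omega pe)
  (continuity_eq : forall k t x, J t -> Omega x ->
    dt (rho k) t x + div (fun y => rho k t y *: v k t y) x = 0)
  (momentum_eq : forall k t x, J t -> Omega x ->
    dt (fun s y => rho k s y *: v k s y) t x
    + div_tensor (momentum_flux rho v p k t) x
    + (r k * rho k t x) *: drift_force r rho v B k t x
    - (r k * rho k t x / electron_charge r rho t x) *: electron_force B pe t x
    = 0)
  (energy_eq : forall k t x, J t -> Omega x ->
    dt (total_energy gamma rho v p B k) t x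
    + div (fun y => (hydro_energy gamma rho v p k t y + p k t y) *: v k t y) x
    + r k * rho k t x * dot (v k t x) (drift_force r rho v B k t x)
    - dot ((r k * rho k t x / electron_charge r rho t x) *: v k t x)
          (electron_force B pe t x)
    - dot (B t x) (induction_term r rho v B t x) = 0)
  (induction_eq : forall t x, J t -> Omega x ->
    dt B t x - induction_term r rho v B t x = 0) :
  forall t x, J t -> Omega x ->
    dt (entropy gamma rho p) t x + div (entropy_flux gamma rho v p t) x = 0.
Proof.
move=> t x Jt Ox; case: Omega_domain => _ Omega_open _.
have JOx := joint_near J_open Omega_open Jt Ox.
have gamma_neq1 k : gamma k != 1 by rewrite gt_eqF.
have drho k w := smooth_on_derivable (w := w) (rho_smooth k) Jt Ox.
have dB w := smooth_on_derivable (w := w) B_smooth Jt Ox.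
have dE k w := smooth_on_derivable (w := w) (energy_smooth k) Jt Ox.
have dm k w := smooth_on_derivable (w := w) (momentum_smooth k) Jt Ox.
have dv k i w : derivable (joint (fun s y => v k s y 0 i)) (t, x) w.
  apply: (@derivable_quotient _ _
    (joint (fun s y => (rho k s y *: v k s y) 0 i)) (joint (rho k))) => //.
  - near=> z; apply: lt0r_neq0.
    have [Jz Oz] : J z.1 /\ Omega z.2 by near: z.
    exact: rho_gt0.
  - by move=> z; rewrite /joint mxE.
  - exact: (derivable_coord (i := i) (dm k w)).
have dp k w : derivable (joint (p k)) (t, x) w.
  exact: (derivable_pressure (gamma_neq1 k) (drho k w) (dv k ^~ w) (dB w)
    (dE k w)).
have rho0 k := rho_gt0 k t x Jt Ox.
have p0 k := p_gt0 k t x Jt Ox.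
rewrite entropy_balance_sum// big1// => k _.
pose q := r k * rho k t x.
apply: (species_entropy_balance rho0 p0 drho dp dv
  (f := q *: drift_force r rho v B k t x
   - (q / electron_charge r rho t x) *: electron_force B pe t x)) => //.
- exact: continuity_eq.
- by rewrite addrA; exact: momentum_eq.
- have magnetic : dt (total_energy gamma rho v p B k) t x =
      dt (hydro_energy gamma rho v p k) t x
      + dot (B t x) (induction_term r rho v B t x).
    rewrite -(subr0_eq (induction_eq t x Jt Ox)) !dt_joint.
    exact: (derive_total_energy gamma (derivableP (drho k _))
      (derivableP (dp k _)) (fun i => derivableP (dv k i _)) (dB _)).
  rewrite -[RHS](energy_eq k t x Jt Ox) magnetic dot_scaleB -/q.
  by ring.
Unshelve. all: by end_near. Qed.
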